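(* Let $\mathbb{K}$ be a field and let $r$ be a positive integer. The polynomial ring $\mathbb{K}[X_{[r]\times\mathbb{P}}]$ is a Noetherian (left) $\mathbb{K}[X_{[r]\times\mathbb{P}}]\ast\mathfrak{S}_{\mathbb{P}}$-module.
   Context: $\mathbb{P}=\{1,2,3,\dots\}$ is the set of positive integers and $[r]=\{1,\dots,r\}$. $\mathbb{K}[X_{[r]\times\mathbb{P}}]$ is the commutative polynomial ring over $\mathbb{K}$ in the indeterminates $x_{i,j}$ with $i\in[r]$, $j\in\mathbb{P}$. $\mathfrak{S}_{\mathbb{P}}$ is the group of all permutations of $\mathbb{P}$, acting on $\mathbb{K}[X_{[r]\times\mathbb{P}}]$ by $\mathbb{K}$-algebra automorphisms via $\sigma\cdot x_{i,j}=x_{i,\sigma(j)}$. The skew-monoid ring $\mathbb{K}[X_{[r]\times\mathbb{P}}]\ast\mathfrak{S}_{\mathbb{P}}$ is the set of formal finite $\mathbb{K}$-linear combinations $\sum_i c_i q_i\sigma_i$ with $c_i\in\mathbb{K}$, $q_i$ a monomial of $\mathbb{K}[X_{[r]\times\mathbb{P}}]$ and $\sigma_i\in\mathfrak{S}_{\mathbb{P}}$, with multiplication $q_1\sigma_1\cdot q_2\sigma_2=q_1(\sigma_1 q_2)(\sigma_1\sigma_2)$ extended by distributivity. It acts on $\mathbb{K}[X_{[r]\times\mathbb{P}}]$ on the left by $(q\sigma)\cdot f=q\,(\sigma\cdot f)$. Its submodules are exactly the ideals of $\mathbb{K}[X_{[r]\times\mathbb{P}}]$ that are stable under $\mathfrak{S}_{\mathbb{P}}$.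 *)

(* Defs.v *)
From HB Require Import structures.
From mathcomp Require Import all_boot all_order all_algebra.
From mathcomp Require Import finmap boolp monalg.

Set Implicit Arguments.
Unset Strict Implicit.
Unset Printing Implicit Defensive.

Import GRing.Theory.
Local Open Scope fset_scope.
Local Open Scope ring_scope.

Definition pos_nat := {n : nat | (0 < n)%N}.

HB.instance Definition _ := Countable.on pos_nat.

(* The group of all permutations of T, under composition (s * t) x = s (t x). *)
Record permutation (T : Type) :=
  Permutation { perm_fun :> T -> T; permutation_bij : bijective perm_fun }.

HB.instance Definition _ (T : Type) := gen_eqMixin (permutation T).
HB.instance Definition _ (T : Type) := gen_choiceMixin (permutation T).

Section PermutationGroup.
Variable T : Type.
Implicit Types s t u : permutation T.

Lemma permutationP s t : s =1 t -> s = t.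
Proof.
case: s t => [f fb] [g gb] /= /funext fg; case: _ / fg in gb *.
by congr Permutation; apply: Prop_irrelevance.
Qed.

Definition perm_id : permutation T :=
  Permutation (@Bijective _ _ id id (fun=> erefl) (fun=> erefl)).

Definition perm_comp s t : permutation T :=
  Permutation (bij_comp (permutation_bij s) (permutation_bij t)).

Lemma perm_inv_ex s : {t : permutation T | cancel t s & cancel s t}.
Proof.
suff /cid[t [? ?]] : exists t : permutation T, cancel t s /\ cancel s t.
  by exists t.
have [g sK gK] := permutation_bij s.
by exists (Permutation (Bijective gK sK)).
Qed.

Definition perm_inv s : permutation T := s2val (perm_inv_ex s).

Lemma perm_compA : associative perm_comp.
Proof. by move=> s t u; apply: permutationP. Qed.

Lemma perm_comp1s : left_id perm_id perm_comp.
Proof. by move=> s; apply: permutationP. Qed.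

Lemma perm_comps1 : right_id perm_id perm_comp.
Proof. by move=> s; apply: permutationP. Qed.

Lemma perm_compVs : left_inverse perm_id perm_inv perm_comp.
Proof. by move=> s; apply/permutationP/(s2valP' (perm_inv_ex s)). Qed.

Lemma perm_compsV : right_inverse perm_id perm_inv perm_comp.
Proof. by move=> s; apply/permutationP/(s2valP (perm_inv_ex s)). Qed.

HB.instance Definition _ := isGroup.Build (permutation T)
  perm_compA perm_comp1s perm_comps1 perm_compVs perm_compsV.

Lemma permutation1 (x : T) : (1%g : permutation T) x = x.
Proof. by []. Qed.

Lemma permutationM s t x : (s * t)%g x = s (t x).
Proof. by []. Qed.

Lemma permutationK s : cancel s (s^-1)%g.
Proof. exact: (s2valP' (perm_inv_ex s)). Qed.

Lemma permutationVK s : cancel (s^-1)%g s.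
Proof. exact: (s2valP (perm_inv_ex s)). Qed.
End PermutationGroup.

Section MonoidAlgebra.
Variables (M : monoidType) (R : nzRingType).
Local Notation A := {malg R[M]}.
Implicit Types (a b c : A).

Definition ma_one : A := << 1%g >>.

Definition ma_mul a b : A :=
  \sum_(k <- msupp a) \sum_(l <- msupp b) << a@_k * b@_l *g (k * l)%g >>.

Lemma ma_mulEw (d1 d2 : {fset M}) a b :
  msupp a `<=` d1 -> msupp b `<=` d2 ->
  ma_mul a b = \sum_(k <- d1) \sum_(l <- d2) << a@_k * b@_l *g (k * l)%g >>.
Proof.
move=> le_d1 le_d2; rewrite /ma_mul (big_fset_incl _ le_d1) /=.
  apply/eq_bigr=> k1 _; apply/big_fset_incl => // k _ /mcoeff_outdom ->.
  by rewrite mulr0 monalgU0.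
move=> k _ /mcoeff_outdom ak.
by rewrite big1 => // k' _; rewrite ak mul0r monalgU0.
Qed.

Lemma ma_mulUU x y (k l : M) :
  ma_mul << x *g k >> << y *g l >> = << x * y *g (k * l)%g >>.
Proof. by rewrite (ma_mulEw msuppU_le msuppU_le) !big_seq_fset1 !mcoeffUU. Qed.

Lemma ma_mulDl : left_distributive ma_mul +%R.
Proof.
move=> a b c.
rewrite (ma_mulEw (msuppD_le a b) (fsubset_refl _)).
rewrite (ma_mulEw (fsubsetUl (msupp a) (msupp b)) (fsubset_refl (msupp c))).
rewrite (ma_mulEw (fsubsetUr (msupp a) (msupp b)) (fsubset_refl (msupp c))).
rewrite -big_split /=; apply/eq_bigr=> k _.
rewrite -big_split /=; apply/eq_bigr=> l _.
by rewrite mcoeffD mulrDl monalgUD.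
Qed.

Lemma ma_mulDr : right_distributive ma_mul +%R.
Proof.
move=> c a b.
rewrite (ma_mulEw (fsubset_refl _) (msuppD_le a b)).
rewrite (ma_mulEw (fsubset_refl (msupp c)) (fsubsetUl (msupp a) (msupp b))).
rewrite (ma_mulEw (fsubset_refl (msupp c)) (fsubsetUr (msupp a) (msupp b))).
rewrite -big_split /=; apply/eq_bigr=> k _.
rewrite -big_split /=; apply/eq_bigr=> l _.
by rewrite mcoeffD mulrDr monalgUD.
Qed.

Lemma ma_mul0l : left_zero 0 ma_mul.
Proof. by move=> a; rewrite /ma_mul msupp0 big_seq_fset0. Qed.

Lemma ma_mul0r : right_zero 0 ma_mul.
Proof.
by move=> a; rewrite /ma_mul msupp0 big1 // => k _; rewrite big_seq_fset0.
Qed.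

Lemma ma_mul_suml (I : Type) (r : seq I) (F : I -> A) b :
  ma_mul (\sum_(i <- r) F i) b = \sum_(i <- r) ma_mul (F i) b.
Proof.
exact: (big_morph (ma_mul^~ b) (fun _ _ => ma_mulDl _ _ _) (ma_mul0l b)).
Qed.

Lemma ma_mul_sumr (I : Type) (r : seq I) (F : I -> A) a :
  ma_mul a (\sum_(i <- r) F i) = \sum_(i <- r) ma_mul a (F i).
Proof.
exact: (big_morph (ma_mul a) (fun _ _ => ma_mulDr _ _ _) (ma_mul0r a)).
Qed.

Lemma ma_mulA : associative ma_mul.
Proof.
move=> a b c; rewrite [a]monalgE (ma_mul_suml _ _ (ma_mul b c)).
rewrite (ma_mul_suml _ _ b) (ma_mul_suml _ _ c); apply/eq_bigr=> k _.
move: a@_k => x; rewrite [b]monalgE (ma_mul_suml _ _ c).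
rewrite !(ma_mul_sumr _ _ << x *g k >>) (ma_mul_suml _ _ c).
apply/eq_bigr=> l _; move: b@_l => y; rewrite ma_mulUU [c]monalgE.
rewrite (ma_mul_sumr _ _ << y *g l >>) !ma_mul_sumr; apply/eq_bigr=> n _.
by rewrite !ma_mulUU mulrA mulgA.
Qed.

Lemma ma_mul1l : left_id ma_one ma_mul.
Proof.
move=> a; rewrite [a in LHS]monalgE ma_mul_sumr [RHS]monalgE.
by apply/eq_bigr=> k _; rewrite ma_mulUU mul1r mul1g.
Qed.

Lemma ma_mul1r : right_id ma_one ma_mul.
Proof.
move=> a; rewrite [a in LHS]monalgE ma_mul_suml [RHS]monalgE.
by apply/eq_bigr=> k _; rewrite ma_mulUU mulr1 mulg1.
Qed.

Lemma ma_one_neq0 : ma_one != 0.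
Proof. by apply/eqP/malgP=> /(_ 1%g)/eqP; rewrite mcoeffUU mcoeff0 oner_eq0. Qed.
End MonoidAlgebra.

(* The monoid algebra of a not necessarily commutative monoid M over R; the    *)
(* ring structure of {malg R[M]} in monalg excludes monoids with nontrivial    *)
(* units, such as groups.                                                      *)
Definition monoid_alg (M : monoidType) (R : nzRingType) := {malg R[M]}.

HB.instance Definition _ (M : monoidType) (R : nzRingType) :=
  GRing.Lmodule.on (monoid_alg M R).
HB.instance Definition _ (M : monoidType) (R : nzRingType) :=
  GRing.Zmodule_isNzRing.Build (monoid_alg M R)
    (@ma_mulA M R) (@ma_mul1l M R) (@ma_mul1r M R)
    (@ma_mulDl M R) (@ma_mulDr M R) (@ma_one_neq0 M R).

(* Monomials in the x_(i,j), i in [r], j in P; the index set [r] = {1,...,r}   *)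
(* is represented by 'I_r.                                                     *)
Notation mnm_rP r := {cmonom ('I_r * pos_nat)%type}.

Notation poly_rP K r := {malg K[mnm_rP r]}.

Notation symP := (permutation pos_nat).

Section Action.
Variables (K : fieldType) (r : nat).
Implicit Types (s t : symP) (m n : mnm_rP r).

Definition indet (i : 'I_r) (j : pos_nat) : poly_rP K r := << ucm (i, j) >>.

(* The exponent of x_(i,j) in s . m is that of x_(i,s^-1 j) in m. *)
Definition mnm_act s m : mnm_rP r :=
  [cmonom m (x.1, (s^-1)%g x.2) | x in [fset (y.1, s y.2) | y in finsupp m]]%M.

Lemma mnm_actE s m x : mnm_act s m x = m (x.1, (s^-1)%g x.2).
Proof.
rewrite cmE fsfun_fun; case: ifP => // /negbT xN.
apply/esym/eqP; rewrite cmE_eq0; apply: contra xN => mx.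
apply/imfsetP; exists (x.1, (s^-1)%g x.2) => //=.
by rewrite permutationVK -surjective_pairing.
Qed.

Lemma mnm_actU s i j : mnm_act s (ucm (i, j)) = ucm (i, s j).
Proof.
apply/eqP/cmP => -[i' j']; rewrite mnm_actE !cmU /= !xpair_eqE.
by rewrite -(can_eq (permutationK s)) permutationVK.
Qed.

Lemma mnm_act1 m : mnm_act 1%g m = m.
Proof.
by apply/eqP/cmP => -[i j]; rewrite mnm_actE invg1.
Qed.

Lemma mnm_actM s t m : mnm_act (s * t)%g m = mnm_act s (mnm_act t m).
Proof. by apply/eqP/cmP => x; rewrite !mnm_actE /= invgM. Qed.

Lemma mnm_act_one s : mnm_act s mone = mone.
Proof. by apply/eqP/cmP => x; rewrite mnm_actE !cm1. Qed.

Lemma mnm_act_mul s m n : mnm_act s (mmul m n) = mmul (mnm_act s m) (mnm_act s n).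
Proof. by apply/eqP/cmP => x; rewrite !(mnm_actE, cmM). Qed.

Definition mnm_act_poly s m : poly_rP K r := << mnm_act s m >>.

Lemma mnm_act_poly_mmorphism s : mmorphism (mnm_act_poly s).
Proof.
split=> [m n|]; last by rewrite /mnm_act_poly mnm_act_one.
by rewrite /mnm_act_poly mnm_act_mul [RHS]fgmulUU mulr1.
Qed.

HB.instance Definition _ s :=
  monalg.isMultiplicative.Build (mnm_rP r) (poly_rP K r) (mnm_act_poly s)
    (mnm_act_poly_mmorphism s).
End Action.

(* The K-algebra endomorphism sum_m f_m m |-> sum_m f_m (s . m); it is locked  *)
(* since unification otherwise tends to unfold it when comparing products.     *)
HB.lock Definition poly_act (K : fieldType) (r : nat) (s : symP) :
    poly_rP K r -> poly_rP K r :=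
  mmap (@malgC (mnm_rP r) K) (@mnm_act_poly K r s).
Canonical poly_act_unlockable := Unlockable poly_act.unlock.

Section PolyAction.
Variables (K : fieldType) (r : nat).
Implicit Types (s t : symP) (m n : mnm_rP r) (f g : poly_rP K r).
Local Notation poly_act := (@poly_act K r).

Lemma poly_actE s f :
  poly_act s f = mmap (@malgC (mnm_rP r) K) (@mnm_act_poly K r s) f.
Proof. by rewrite unlock. Qed.

Lemma poly_act_is_zmod_morphism s : zmod_morphism (poly_act s).
Proof. by move=> f g; rewrite !poly_actE raddfB. Qed.

Lemma poly_act_is_monoid_morphism s : monoid_morphism (poly_act s).
Proof. by split=> [|f g]; rewrite !poly_actE ?rmorph1 ?rmorphM. Qed.

HB.instance Definition _ s :=
  GRing.isZmodMorphism.Build (poly_rP K r) (poly_rP K r) (poly_act s)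
    (poly_act_is_zmod_morphism s).
HB.instance Definition _ s :=
  GRing.isMonoidMorphism.Build (poly_rP K r) (poly_rP K r) (poly_act s)
    (poly_act_is_monoid_morphism s).

Lemma poly_actU s c m :
  poly_act s << c *g m >> = << c *g mnm_act s m >>.
Proof. by rewrite poly_actE [LHS]mmapU [LHS]fgmulUU mulr1 mul1m. Qed.

Lemma poly_actZ s c f : poly_act s (c *: f) = c *: poly_act s f.
Proof. by rewrite -!mul_malgC rmorphM /= poly_actU mnm_act_one. Qed.

HB.instance Definition _ s :=
  GRing.isScalable.Build K (poly_rP K r) (poly_rP K r) *:%R (poly_act s)
    (poly_actZ s).

Lemma poly_actX s i j : poly_act s (indet K i j) = indet K i (s j).
Proof. by rewrite /indet poly_actU mnm_actU. Qed.

Lemma poly_act1 f : poly_act 1%g f = f.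
Proof.
rewrite [f in LHS]monalgE raddf_sum [RHS]monalgE; apply/eq_bigr => m _ /=.
by rewrite poly_actU mnm_act1.
Qed.

Lemma poly_actM s t f : poly_act (s * t)%g f = poly_act s (poly_act t f).
Proof.
rewrite [f]monalgE raddf_sum [poly_act t _]raddf_sum [RHS]raddf_sum /=.
by apply/eq_bigr => m _; rewrite !poly_actU mnm_actM.
Qed.
End PolyAction.

(* The pair (q, s) is the product q s of the monomial q and the permutation s. *)
Definition skew_mon (r : nat) := (mnm_rP r * symP)%type.

Section SkewMonoid.
Variable r : nat.
Implicit Types k l n : skew_mon r.

HB.instance Definition _ := Choice.on (skew_mon r).

Definition skew_one : skew_mon r := (mone, 1%g).

Definition skew_mul k l : skew_mon r :=
  (mmul k.1 (mnm_act k.2 l.1), (k.2 * l.2)%g).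

Lemma skew_mulA : associative skew_mul.
Proof.
by move=> k l n; rewrite /skew_mul /= mnm_act_mul mulmA mnm_actM mulgA.
Qed.

Lemma skew_mul1l : left_id skew_one skew_mul.
Proof. by case=> q s; rewrite /skew_mul /= mnm_act1 mul1m mul1g. Qed.

Lemma skew_mul1r : right_id skew_one skew_mul.
Proof. by case=> q s; rewrite /skew_mul /= mnm_act_one mulm1 mulg1. Qed.

HB.instance Definition _ := isMonoid.Build (skew_mon r)
  skew_mulA skew_mul1l skew_mul1r.
End SkewMonoid.

Definition skew_ring (K : fieldType) (r : nat) := monoid_alg (skew_mon r) K.

(* The polynomial ring as a left module over the skew-monoid ring, rather than *)
(* over K.                                                                     *)
Definition poly_module (K : fieldType) (r : nat) := poly_rP K r.

Section SkewModule.
Variables (K : fieldType) (r : nat).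
Local Notation S := (skew_ring K r).
Implicit Types (a b : S) (f g : poly_rP K r) (k l : skew_mon r).

HB.instance Definition _ := GRing.NzRing.on S.
HB.instance Definition _ := GRing.Zmodule.on (poly_module K r).

Definition skew_mon_act k f : poly_rP K r := << k.1 >> * poly_act k.2 f.

Definition skew_scale a f : poly_rP K r :=
  \sum_(k <- msupp a) a@_k *: skew_mon_act k f.

Lemma skew_mon_act_is_linear k : linear (skew_mon_act k).
Proof.
move=> c f g; rewrite /skew_mon_act linearP mulrDr; congr (_ + _).
by rewrite -scalerAr.
Qed.

HB.instance Definition _ k := GRing.isLinear.Build K (poly_rP K r)
  (poly_rP K r) *:%R (skew_mon_act k) (skew_mon_act_is_linear k).

Lemma skew_mon_actM k l f :
  skew_mon_act (k * l)%g f = skew_mon_act k (skew_mon_act l f).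
Proof.
rewrite /skew_mon_act poly_actM.
rewrite rmorphM /= poly_actU [RHS]mulrA; congr (_ * _).
by rewrite [RHS]fgmulUU mulr1.
Qed.

Lemma skew_mon_act1 f : skew_mon_act 1%g f = f.
Proof. by rewrite /skew_mon_act poly_act1 mul1r. Qed.

Lemma skew_scaleEw (d : {fset skew_mon r}) a f : msupp a `<=` d ->
  skew_scale a f = \sum_(k <- d) a@_k *: skew_mon_act k f.
Proof.
move=> le; apply/big_fset_incl => // k _ /mcoeff_outdom ->.
by rewrite scale0r.
Qed.

Lemma skew_scaleU c k f :
  skew_scale << c *g k >> f = c *: skew_mon_act k f.
Proof. by rewrite (skew_scaleEw _ msuppU_le) big_seq_fset1 mcoeffUU. Qed.

Lemma skew_scaleDl f : {morph skew_scale^~ f : a b / a + b}.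
Proof.
move=> a b /=; rewrite (skew_scaleEw _ (msuppD_le a b)).
rewrite (skew_scaleEw _ (fsubsetUl (msupp a) (msupp b))).
rewrite (skew_scaleEw _ (fsubsetUr (msupp a) (msupp b))) -big_split /=.
by apply/eq_bigr => k _; rewrite mcoeffD scalerDl.
Qed.

Lemma skew_scale_suml (I : Type) (e : seq I) (F : I -> S) f :
  skew_scale (\sum_(i <- e) F i) f = \sum_(i <- e) skew_scale (F i) f.
Proof.
apply: (big_morph (skew_scale^~ f) (skew_scaleDl f)).
by rewrite /skew_scale msupp0 big_seq_fset0.
Qed.

Lemma skew_scaleDr : right_distributive skew_scale +%R.
Proof.
move=> a f g; rewrite -big_split; apply/eq_bigr => k _.
by rewrite linearD scalerDr.
Qed.

Lemma skew_scale_sumr (I : Type) (e : seq I) (F : I -> poly_rP K r) a :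
  skew_scale a (\sum_(i <- e) F i) = \sum_(i <- e) skew_scale a (F i).
Proof.
apply: (big_morph (skew_scale a) (skew_scaleDr a)).
by rewrite /skew_scale big1 // => k _; rewrite linear0 scaler0.
Qed.

Lemma skew_scaleA a b f : skew_scale a (skew_scale b f) = skew_scale (a * b) f.
Proof.
rewrite [a]monalgE mulr_suml !skew_scale_suml; apply/eq_bigr => k _.
rewrite [b]monalgE mulr_sumr !skew_scale_suml skew_scale_sumr.
apply/eq_bigr => l _.
rewrite [X in _ = skew_scale X _]ma_mulUU.
rewrite [RHS]skew_scaleU [LHS]skew_scaleU skew_scaleU.
by rewrite linearZ skew_mon_actM scalerA.
Qed.

Lemma skew_scale1 : left_id 1 skew_scale.
Proof. by move=> f; rewrite skew_scaleU scale1r skew_mon_act1. Qed.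

HB.instance Definition _ := GRing.Zmodule_isLmodule.Build S (poly_module K r)
  skew_scaleA skew_scale1 skew_scaleDr skew_scaleDl.

Lemma skew_ringM (q1 q2 : mnm_rP r) (s1 s2 : symP) (c1 c2 : K) :
  (<< c1 *g (q1, s1) >> : S) * (<< c2 *g (q2, s2) >> : S) =
  << c1 * c2 *g (mmul q1 (mnm_act s1 q2), (s1 * s2)%g) >>.
Proof. exact: ma_mulUU. Qed.

Lemma poly_module_scale (c : K) (q : mnm_rP r) (s : symP) f :
  (<< c *g (q, s) >> : S) *: (f : poly_module K r) =
  c *: (<< q >> * poly_act s f).
Proof. exact: skew_scaleU. Qed.
End SkewModule.

Definition finitely_generated (R : nzRingType) (V : lmodType R)
    (N : {pred V}) : Prop :=
  exists n (g : 'I_n -> V), (forall i, g i \in N) /\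
    (forall v, v \in N -> exists c : 'I_n -> R, v = \sum_(i < n) c i *: g i).

(* Every subset is a boolean predicate by classical logic, so that N ranges    *)
(* over all submodules.                                                        *)
Definition noetherian_module (R : nzRingType) (V : lmodType R) : Prop :=
  forall N : {pred V}, submod_closed N -> finitely_generated N.

(* Main.v *)
Require Import Defs.
From mathcomp Require Import all_boot all_algebra.
From mathcomp Require Import finmap boolp monalg.

Set Implicit Arguments.
Unset Strict Implicit.
Unset Printing Implicit Defensive.

Import GRing.Theory.

(** The proof is a Groebner basis argument in infinitely many variables, made
possible by a well-quasi-order that takes the symmetry into account.

Read a monomial as a word whose [j]-th letter is the vector of exponents of
x_(1,j), ..., x_(r,j). Letters are well-quasi-ordered by the pointwise order
(Dickson), so words are well-quasi-ordered by embedding (Higman, [higman]). An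
embedding of the word of [m] into that of [n] is a strictly increasing
relabelling [p] of the columns such that p.m divides n; this is
[shift_divides m n]. An increasing map is not a permutation, but on the finitely
many columns that occur in a given polynomial it agrees with one
([injection_extends_to_permutation]), so the skew-monoid ring can perform the
relabelling.

Monomials carry a total order [mlt], compatible with products and with increasing
relabellings of the columns. It is a well-order because it extends the
well-quasi-order above: a descending chain would be a bad sequence.

For a submodule N, finitely many leading monomials of elements of N suffice to
shift-divide all others ([wqo_finite_basis]). The corresponding elements generate
N: if the leading monomial of a generator [g] shift-divides that of [f], some
multiple [a *: g] by a scalar of the skew-monoid ring cancels the leading term
of [f] and only brings in smaller monomials ([reduction]), and well-founded
induction concludes. *)

(** * Well-quasi-orders *)

Definition wqo (T : Type) (R : T -> T -> Prop) : Prop :=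
  forall f : nat -> T, exists i j, (i < j)%N /\ R (f i) (f j).

Definition has_monotone_subseq (T : Type) (R : T -> T -> Prop) : Prop :=
  forall f : nat -> T, exists2 g : nat -> nat,
    {homo g : i j / (i < j)%N} & forall i j, (i < j)%N -> R (f (g i)) (f (g j)).

(** Otherwise, keep picking an element of [P] that no earlier choice lies below:
the choices form a sequence without any increasing pair. *)
Lemma wqo_finite_basis (T : eqType) (R : T -> T -> Prop) (P : T -> Prop) :
  wqo R -> exists2 b : seq T, (forall x, x \in b -> P x) &
    (forall y, P y -> exists2 x, x \in b & R x y).
Proof.
move=> wqoR; apply: contrapT => noB.
have next (l : seq T) : {y | (forall x, x \in l -> P x) ->
    P y /\ forall x, x \in l -> ~ R x y}.
  apply: cid; apply: contrapT => noy; apply: noB.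
  have [lP|lN] := pselect (forall x, x \in l -> P x); last first.
    case: l => [|x0 l] in noy lN *; first by case: lN.
    by case: noy; exists x0 => /lN.
  exists l => // y Py; apply: contrapT => yN; apply: noy; exists y => _.
  by split=> // x xl Rxy; apply: yN; exists x.
pose F := fix F n := if n is m.+1 then sval (next (F m)) :: F m else [::].
have FP n x : x \in F n -> P x.
  elim: n x => //= n IHn x; rewrite inE => /predU1P[->|/IHn//].
  by case: (svalP (next (F n))).
have inF i j : (i < j)%N -> sval (next (F i)) \in F j.
  elim: j => // j IHj; rewrite ltnS leq_eqVlt /= inE => /predU1P[->|/IHj->].
    by rewrite eqxx.
  by rewrite orbT.
have [i [j [ij Rij]]] := wqoR (fun n => sval (next (F n))).
by have [_ /(_ _ (inF _ _ ij))] := svalP (next (F j)) (@FP j).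
Qed.

Lemma strictly_increasing_homo (g : nat -> nat) :
  (forall n, (g n < g n.+1)%N) -> {homo g : i j / (i < j)%N}.
Proof.
move=> gS i j; elim: j => // j IHj; rewrite ltnS leq_eqVlt => /predU1P[->//|ij].
exact: ltn_trans (IHj ij) (gS j).
Qed.

(** Each index of the subsequence is chosen so that its value is minimal among all
values beyond the previous index. *)
Lemma leq_monotone_subseq : has_monotone_subseq leq.
Proof.
move=> f.
have next k : {k' | (k < k')%N /\ forall l, (k < l)%N -> (f k' <= f l)%N}.
  apply: cid.
  have ex : exists v, `[< exists2 k', (k < k')%N & f k' = v >].
    by exists (f k.+1); apply/asboolP; exists k.+1.
  have /asboolP[k' kk' fk'] := xchooseP ex.
  case: (ex_minnP ex) => v /asboolP[l kl <-] min.
  by exists l; split=> // l' kl'; apply: min; apply/asboolP; exists l'.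
pose G := fix G n := if n is m.+1 then sval (next (G m)) else sval (next 0%N).
have GS n : (G n < G n.+1)%N by have [] := svalP (next (G n)).
exists G; first exact: strictly_increasing_homo.
move=> i j ij; have Gij := strictly_increasing_homo GS ij.
case: i => [|i] in ij Gij *; first by
  case: (svalP (next 0%N)) => _; apply; case: (G j) Gij.
have [_] := svalP (next (G i)); apply.
exact: ltn_trans (GS i) Gij.
Qed.

(** Dickson's lemma. Monotone subsequences, unlike mere increasing pairs, can be
refined one coordinate at a time. *)
Lemma pointwise_monotone_subseq (I : eqType) (s : seq I) :
  has_monotone_subseq
    (fun u v : I -> nat => forall i, i \in s -> (u i <= v i)%N).
Proof.
move=> f; elim: s => [|a s [g gi gP]]; first by exists id.
have [h hi hP] := leq_monotone_subseq (fun n => f (g n) a).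
exists (g \o h) => [i j /hi /gi //|i j ij b]; rewrite inE => /predU1P[->|bs].
  exact: hP.
by apply: gP => //; apply: hi.
Qed.

(** Higman's embedding order. The position map is total on [nat], not only defined on
the positions of [u], so that it directly gives an increasing relabelling of all
columns. *)
Definition embeds (A : Type) (x0 : A) (R : A -> A -> Prop) (u v : seq A) :=
  exists2 g : nat -> nat, {homo g : i j / (i < j)%N} &
    forall k, (k < size u)%N ->
      (g k < size v)%N /\ R (nth x0 u k) (nth x0 v (g k)).

Section Higman.
Variables (A : Type) (x0 : A) (R : A -> A -> Prop).
Local Notation emb := (embeds x0 R).
Hypothesis monoR : has_monotone_subseq R.

Lemma embeds_nil v : emb [::] v. Proof. by exists id. Qed.

Lemma embeds_behead u v : emb u (behead v) -> emb u v.
Proof.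
case: v => //= a v [g gi gP]; exists (fun k => (g k).+1) => [i j /gi //|k ku].
exact: gP.
Qed.

Lemma embeds_cons u v : u <> [::] -> v <> [::] ->
  R (head x0 u) (head x0 v) -> emb (behead u) (behead v) -> emb u v.
Proof.
case: u v => [|a u] [|b v] //= _ _ Rab [g gi gP].
exists (fun k => if k is l.+1 then (g l).+1 else 0%N); last by case=> //= k /gP.
by case=> [|i] [|j] //; rewrite !ltnS => /gi.
Qed.

Definition bad (f : nat -> seq A) := forall i j, (i < j)%N -> ~ emb (f i) (f j).

(** The n-th term is chosen of minimal length among the n-th terms of the bad
sequences that continue the terms already chosen. *)
Lemma minimal_bad_sequence f : bad f ->
  exists2 h, bad h & forall n h', bad h' ->
    (forall i, (i < n)%N -> h' i = h i) -> (size (h n) <= size (h' n))%N.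
Proof.
move=> badf.
pose agree n (p q : nat -> seq A) := forall i, (i < n)%N -> p i = q i.
have next n (p : {p | bad p}) : {q : {q | bad q} | agree n (sval q) (sval p) /\
    forall h, bad h -> agree n h (sval p) -> (size (sval q n) <= size (h n))%N}.
  apply: cid.
  have ex : exists v, `[< exists2 q : {q | bad q}, agree n (sval q) (sval p) &
      size (sval q n) = v >].
    by exists (size (sval p n)); apply/asboolP; exists p.
  case: (ex_minnP ex) => v /asboolP[q qp <-] min.
  exists q; split=> // h hb hp; apply: min; apply/asboolP.
  by exists (exist _ h hb).
pose F := fix F n := if n is m.+1 then sval (next m (F m)) else exist _ f badf.
have FS n : agree n (sval (F n.+1)) (sval (F n)) := (svalP (next n (F n))).1.
(* Once chosen, a term is never changed: the diagonal [h] is the limit. *)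
have FD n d : agree n (sval (F (n + d)%N)) (sval (F n)).
  elim: d => [|d IHd] i iln; first by rewrite addn0.
  by rewrite addnS FS ?IHd // ltn_addr.
pose h n := sval (F n.+1) n.
have hE n i : (i < n)%N -> h i = sval (F n) i.
  by move=> iln; rewrite /h -(subnKC iln) FD.
exists h => [i j ij|n h' bad' h'E].
  by rewrite (hE j.+1 i) ?(hE j.+1 j) //; [apply: (svalP (F j.+1))|apply: ltnW].
apply: (svalP (next n (F n))).2 => // i iln.
by rewrite h'E // -hE.
Qed.

(** Nash-Williams: in a minimal bad sequence, restrict to a subsequence with
monotone first letters and delete these letters; preceded by the untouched initial
terms, the result is again bad, but has a shorter term. *)
Lemma higman : wqo emb.
Proof.
move=> f0; apply: contrapT => no.
have badf0 : bad f0 by move=> i j ij Eij; apply: no; exists i, j.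
have [f badf minf] := minimal_bad_sequence badf0.
have fN n : f n <> [::].
  by move=> fn0; apply: (badf n n.+1) => //; rewrite fn0; apply: embeds_nil.
have [g gi gP] := monoR (fun n => head x0 (f n)).
pose h k := if (k < g 0)%N then f k else behead (f (g (k - g 0)%N)).
have g0 k : (g 0 <= g k)%N by case: k => // k; apply/ltnW/gi.
suff badh : bad h.
  have hE i : (i < g 0)%N -> h i = f i by rewrite /h => ->.
  have := minf _ _ badh hE; rewrite /h ltnn subnn size_behead.
  by case: (f (g 0)) (fN (g 0)) => //= a u _; rewrite ltnn.
move=> i j ij; rewrite /h; case: ltnP => ig; case: ltnP => jg.
- exact: badf.
- by move/embeds_behead; apply: badf; apply: leq_trans (g0 _).
- by move: (leq_ltn_trans ig (ltn_trans ij jg)); rewrite ltnn.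
have ijg : (i - g 0 < j - g 0)%N by rewrite ltn_sub2r // (leq_ltn_trans ig).
by move/(embeds_cons (fN _) (fN _) (gP _ _ ijg)); apply/badf/gi.
Qed.
End Higman.

(** * Divisibility of monomials up to an increasing relabelling of columns *)

Definition pos_of (k : nat) : pos_nat := exist _ k.+1 (ltn0Sn k).

Lemma pos_ofK (j : pos_nat) : pos_of (val j).-1 = j.
Proof. by apply/val_inj; rewrite /= prednK //; case: j. Qed.

Definition increasing (p : pos_nat -> pos_nat) :=
  {homo p : j k / (val j < val k)%N}.

Lemma leq_increasing p j : increasing p -> (val j <= val (p j))%N.
Proof.
move=> pi; rewrite leqNgt; apply/negP.
have [v] := ubnP (val j); elim: v j => // v IHv j; rewrite ltnS => jv pj.
exact: (IHv (p j) (leq_trans pj jv) (pi _ _ pj)).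
Qed.

Definition shift_divides (r : nat) (m n : mnm_rP r) : Prop :=
  exists2 p, increasing p & forall i j, (m (i, j) <= n (i, p j))%N.

Definition width (r : nat) (m : mnm_rP r) : nat :=
  \max_(x <- finsupp m) val x.2.

Lemma width_support r (m : mnm_rP r) i j :
  m (i, j) != 0%N -> (val j <= width m)%N.
Proof. by rewrite cmE_neq0 => mij; exact: (leq_bigmax_seq (i, j) mij). Qed.

Definition columns (r : nat) (m : mnm_rP r) : seq ('I_r -> nat) :=
  mkseq (fun k i => m (i, pos_of k)) (width m).

Lemma shift_divides_wqo r : wqo (@shift_divides r).
Proof.
move=> f.
have [a [b [ab [g gi gP]]]] :=
  higman (fun=> 0%N) (pointwise_monotone_subseq (enum 'I_r)) (fun n => columns (f n)).
exists a, b; split=> //; exists (fun j => pos_of (g (val j).-1)) => [j k jk|i j].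
  rewrite /= ltnS; apply: gi; rewrite -ltnS !prednK //; first by case: k {jk}.
  by case: j {jk}.
have [->//|/width_support jw] := eqVneq (f a (i, j)) 0%N.
have {}jw : ((val j).-1 < width (f a))%N by rewrite prednK //; case: j {jw}.
have [] := gP (val j).-1; rewrite !size_mkseq // => gw.
by rewrite !nth_mkseq // => /(_ i (mem_enum _ _)); rewrite pos_ofK.
Qed.

(** * A lexicographic order on monomials *)

(** An encoding of the variables in [nat], so that the order below is a comparison at
the largest index where two finitely supported functions differ. *)
Definition rank (r : nat) (x : 'I_r * pos_nat) : nat := (val x.2 * r + x.1)%N.

Lemma rank_inj r : injective (@rank r).
Proof.
move=> [i j] [i' j']; rewrite /rank /= => E.
have r0 : (0 < r)%N by case: r i {i' E} => // -[].
have := congr1 (divn^~ r) E; rewrite !divnMDl // !divn_small // !addn0 => /val_inj ej.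
by move: E; rewrite ej => /addnI/val_inj ->.
Qed.

Lemma ltn_rank r (x y : 'I_r * pos_nat) :
  (rank x < rank y)%N =
  (val x.2 < val y.2)%N || (val x.2 == val y.2) && (x.1 < y.1)%N.
Proof.
case: x y => [i j] [i' j']; rewrite /rank /=.
have H (a b : nat) (u v : 'I_r) : (a < b)%N -> (a * r + u < b * r + v)%N.
  move=> ab; apply: leq_trans (leq_addr _ _).
  by apply: (@leq_trans (a.+1 * r)); rewrite ?leq_mul2r ?ab ?orbT // mulSnr ltn_add2l.
case: (ltngtP (val j) (val j')) => jj' /=; first exact: H.
  by apply/negbTE; rewrite -leqNgt; apply/ltnW/H.
by rewrite jj' ltn_add2l.
Qed.

Section MonomialOrder.
Variable r : nat.
Implicit Types (m n : mnm_rP r) (x y : 'I_r * pos_nat).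

(** The lexicographic order in which variables of larger rank weigh more. Weighing
later columns more is what makes the order extend [shift_divides]. *)
Definition mlt m n : Prop :=
  exists2 x, (m x < n x)%N & forall y, (rank x < rank y)%N -> m y = n y.

Lemma mlt_irrefl m : ~ mlt m m.
Proof. by case=> x; rewrite ltnn. Qed.

Lemma mlt_trans n m k : mlt m n -> mlt n k -> mlt m k.
Proof.
move=> [x mx xP] [y ny yP]; case: (ltngtP (rank x) (rank y)) => xy.
- exists y => [|z yz]; first by rewrite xP.
  by rewrite xP ?yP // (ltn_trans xy).
- exists x => [|z xz]; first by rewrite -yP.
  by rewrite xP ?yP // (ltn_trans xy).
move/rank_inj: xy => xy; rewrite -{y}xy in ny yP.
exists x => [|z xz]; first exact: ltn_trans ny.
by rewrite xP ?yP.
Qed.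

(** Two distinct monomials differ at finitely many variables, the one of largest rank
decides. *)
Lemma mlt_total m n : m <> n -> mlt m n \/ mlt n m.
Proof.
move=> mn.
pose D := [seq x <- enum_fset (finsupp m) ++ enum_fset (finsupp n) | m x != n x].
have DP x : (x \in D) = (m x != n x).
  rewrite mem_filter mem_cat; case: eqVneq => //= mnx.
  by rewrite -!cmE_neq0; case: (m x) mnx => //; case: (n x).
have [/hasP[x0 Dx0 _]|] := boolP (has predT D); last first.
  rewrite has_predT -eqn0Ngt size_eq0 => /eqP D0.
  by case: mn; apply/eqP/cmP=> x; apply/eqP/negPn; rewrite -DP D0.
have ex : exists v, has (fun x => rank x == v) D.
  by exists (rank x0); apply/hasP; exists x0.
have bnd v : has (fun x => rank x == v) D -> (v <= \max_(x <- D) rank x)%N.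
  by case/hasP=> x Dx /eqP <-; exact: (leq_bigmax_seq x Dx).
case: (ex_maxnP ex bnd) => v /hasP[x Dx /eqP <-] max.
have eqD y : (rank x < rank y)%N -> m y = n y.
  move=> xy; apply/eqP/negPn; rewrite -DP; apply/negP => Dy.
  suff : (rank y <= rank x)%N by rewrite leqNgt xy.
  by apply: max; apply/hasP; exists y.
move: Dx; rewrite DP neq_ltn => /orP[]; [left|right]; exists x => // y xy.
by rewrite eqD.
Qed.

Lemma mlt_mul q m n : mlt m n -> mlt (mmul q m) (mmul q n).
Proof.
case=> x mx xP; exists x => [|y xy]; first by rewrite !cmM ltn_add2l.
by rewrite !cmM xP.
Qed.

(** The order only sees the relative position of the columns that occur, so it is
preserved by any permutation that is increasing on these. *)
Lemma mlt_act (s : symP) (p : pos_nat -> pos_nat) m n :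
  increasing p ->
  (forall x, x \in finsupp m -> s x.2 = p x.2) ->
  (forall x, x \in finsupp n -> s x.2 = p x.2) ->
  mlt m n -> mlt (mnm_act s m) (mnm_act s n).
Proof.
move=> pi sm sn [x mx xP].
have sK j : (s^-1)%g (s j) = j by exact: permutationK.
have sx : s x.2 = p x.2 by apply: sn; rewrite -cmE_neq0; case: (n x) mx.
exists (x.1, s x.2) => [|[i j]]; rewrite !mnm_actE /= ?sK -?surjective_pairing //.
rewrite -[j](permutationVK s); move: {j}((s^-1)%g j) => j; rewrite sK => xj.
have main : s j = p j -> m (i, j) = n (i, j).
  move=> sj; apply: xP; move: xj; rewrite !ltn_rank /= sx sj.
  case: (ltngtP (val x.2) (val j)) => //= [/pi jx|jx].
    by rewrite ltnNge (ltnW jx) /= gtn_eqF.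
  by rewrite (val_inj jx) ltnn eqxx.
have [m0|] := eqVneq (m (i, j)) 0%N; last by rewrite cmE_neq0 => /sm/main.
have [n0|] := eqVneq (n (i, j)) 0%N; last by rewrite cmE_neq0 => /sn/main.
by rewrite m0 n0.
Qed.

(** Suppose that [n] is below [m], decided at (i,j). Then [p] moves [j] to the right,
since n(i,j) < m(i,j) <= n(i,p j), and beyond [j] the two monomials agree, so that
0 < m(i,j) <= n(i,p j) = m(i,p j) <= n(i,p (p j)) = ...: the support of [m] would
contain the whole orbit of [j] under [p], which is infinite. *)
Lemma shift_divides_not_mlt m n : shift_divides m n -> ~ mlt n m.
Proof.
move=> [p pi mn] [[i j] /= nx xP].
pose o k := iter k p j.
have o_gt k : (val (o k) < val (o k.+1))%N.
  elim: k => [|k IHk]; last exact: pi.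
  rewrite ltn_neqAle leq_increasing // andbT; apply/eqP => /val_inj /= jj.
  by move: (mn i j) nx; rewrite -jj ltnNge => ->.
have oi := strictly_increasing_homo o_gt.
have m_pos k : (0 < m (i, o k))%N.
  elim: k => [|k IHk]; first exact: leq_ltn_trans nx.
  rewrite -xP; first exact: leq_trans IHk (mn _ _).
  by rewrite ltn_rank; apply/orP; left; apply: (oi 0%N k.+1).
have : (width m < val (o (width m)))%N.
  elim: (width m) => [|k IHk]; first by case: (o 0%N).
  exact: leq_ltn_trans IHk (o_gt k).
by rewrite ltnNge (width_support (i := i)) // -lt0n.
Qed.

(** A descending chain would contain a pair that increases for [shift_divides]. *)
Lemma mlt_wf : well_founded mlt.
Proof.
move=> m; apply: contrapT => mN.
have next (x : {m | ~ Acc mlt m}) : {y : {m | ~ Acc mlt m} | mlt (sval y) (sval x)}.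
  apply: cid; apply: contrapT => no; apply: (svalP x); split=> y yx.
  by apply: contrapT => yN; apply: no; exists (exist _ y yN).
pose F := fix F k := if k is l.+1 then sval (next (F l)) else exist _ m mN.
have FS k : mlt (sval (F k.+1)) (sval (F k)) := svalP (next (F k)).
have Fi i j : (i < j)%N -> mlt (sval (F j)) (sval (F i)).
  elim: j => // j IHj; rewrite ltnS leq_eqVlt => /predU1P[->//|ij].
  exact: mlt_trans (FS j) (IHj ij).
have [i [j [ij]]] := shift_divides_wqo (fun k => sval (F k)).
by move/shift_divides_not_mlt; apply; apply: Fi.
Qed.

End MonomialOrder.

(** * Permutations *)

Section Permutations.
Variable T : eqType.

Definition swap (a b x : T) := if x == a then b else if x == b then a else x.

Lemma swapK a b : involutive (swap a b).
Proof.
move=> x; rewrite /swap; have [->|xa] := eqVneq x a.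
  by have [->|] := eqVneq b a; rewrite // eqxx.
by have [->|xb] := eqVneq x b; rewrite ?eqxx // (negbTE xa) (negbTE xb).
Qed.

(** By induction on [s]: composing with a transposition corrects the value at one
more point, and by injectivity of [p] leaves the earlier values alone. *)
Lemma injection_extends_to_permutation (p : T -> T) (s : seq T) :
  injective p -> exists t : permutation T, {in s, t =1 p}.
Proof.
move=> p_inj; elim: s => [|a s [t tP]]; first by exists 1%g.
have [/tP ta|aNs] := boolP (a \in s).
  by exists t => b; rewrite inE => /predU1P[->|/tP].
(* [t] sends [a] to [t a] instead of [p a]; exchange these two values. *)
exists (Permutation (inv_bij (swapK (t a) (p a))) * t)%g => b.
rewrite inE permutationM /= /swap => /predU1P[->|bs]; first by rewrite eqxx.
have ba : b != a by apply: contraNneq aNs => <-.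
rewrite (can_eq (permutationK t)) (negbTE ba) tP //.
by rewrite (inj_eq p_inj) (negbTE ba).
Qed.

End Permutations.

(** * Leading monomials and reduction *)

Section Reduction.
Variables (K : fieldType) (r : nat).
Implicit Types (f g : poly_rP K r) (m n q : mnm_rP r) (s : symP).
Local Open Scope ring_scope.

Definition leading f m : Prop :=
  f@_m != 0 /\ forall n, f@_n != 0 -> n = m \/ mlt n m.

Lemma leading_exists f : f != 0 -> exists m, leading f m.
Proof.
rewrite -msupp_eq0 => f0.
have max (l : seq (mnm_rP r)) : l != [::] ->
    exists2 m, m \in l & forall n, n \in l -> n = m \/ mlt n m.
  elim: l => // a [|b l] IHl _.
    by exists a; rewrite ?inE // => n /[!inE] /eqP; left.
  have [//|m ml mP] := IHl.
  have [->|/eqP/mlt_total[am|ma]] := eqVneq a m.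
  - by exists m; rewrite ?mem_head // => n /predU1P[->|/mP//]; left.
  - by exists m; rewrite 1?inE ?ml ?orbT // => n /predU1P[->|/mP//]; right.
  exists a; rewrite ?mem_head // => n /predU1P[->|/mP]; first by left.
  by case=> [->|/mlt_trans/(_ ma)]; right.
case: (max (enum_fset (msupp f))) => [|m mf mP].
  apply: contra_neq f0 => f0; apply/fsetP => x.
  by rewrite -[x \in msupp f]/(x \in enum_fset _) f0.
by exists m; split=> [|n]; rewrite mcoeff_neq0 //; apply: mP.
Qed.

Lemma mcoeff_mul_act q s f n :
  (<< q >> * poly_act s f)@_n =
  \sum_(k <- msupp f) f@_k *+ (mmul q (mnm_act s k) == n).
Proof.
rewrite [in LHS](monalgE f) (raddf_sum (poly_act s)) mulr_sumr (raddf_sum (mcoeff n)).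
apply: eq_bigr => k _ /=; rewrite poly_actU.
by rewrite [X in X@_n]fgmulUU mul1r mcoeffU.
Qed.

Lemma dominated_divides m n :
  (forall x, (m x <= n x)%N) -> exists q, n = mmul q m.
Proof.
move=> mn; exists (divcm n m); apply/esym/eqP/cmP => x.
by rewrite cmM divcmE subnK.
Qed.

(** The list [l] is there to prescribe, beyond the columns of [m], further columns on
which the permutation has to be increasing. *)
Lemma shift_divides_perm m n (l : seq pos_nat) : shift_divides m n ->
  exists q s p, [/\ increasing p, {in l, s =1 p} & n = mmul q (mnm_act s m)].
Proof.
move=> [p pi mn].
have p_inj : injective p.
  move=> j k jk; apply/val_inj; case: (ltngtP (val j) (val k)) => // /pi.
    by rewrite jk ltnn.
  by rewrite jk ltnn.
(* Agreement on the columns of [m] is what makes the image of [m] divide [n]. *)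
pose l' := l ++ [seq x.2 | x <- finsupp m].
have [s sP] := injection_extends_to_permutation l' p_inj.
have [|q ->] := @dominated_divides (mnm_act s m) n; last first.
  by exists q, s, p; split=> // j jl; apply: sP; rewrite mem_cat jl.
case=> i j; rewrite mnm_actE /= -{2}[j](permutationVK s).
move: {j}((s^-1)%g j) => j.
have [->//|] := eqVneq (m (i, j)) 0%N; rewrite cmE_neq0 => mij.
by rewrite sP // mem_cat (map_f snd mij) orbT.
Qed.

(** Choose a permutation that is increasing on all columns of [g], not only on those
of its leading monomial: then the other monomials of [g] stay below the image of
the leading one, which is made to cancel the leading term of [f]. *)
Lemma reduction f g m m' : leading f m -> leading g m' -> shift_divides m' m ->
  exists a : skew_ring K r, forall n,
    (f - (a *: (g : poly_module K r) : poly_module K r))@_n != 0 -> mlt n m.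
Proof.
move=> [fm fP] [gm' gP].
case/(shift_divides_perm
  [seq x.2 | k <- enum_fset (msupp g), x <- enum_fset (finsupp (k : mnm_rP r))]).
move=> q [s [p [pi sp mE]]].
have lt k : g@_k != 0 -> k = m' \/ mlt (mmul q (mnm_act s k)) m.
  have sk h x : g@_h != 0 -> x \in finsupp h -> s x.2 = p x.2.
    rewrite mcoeff_neq0 => hg xh; apply: sp; apply/allpairsPdep.
    by exists h, x.
  move=> gk; case: (gP k gk) => [|km']; [by left|right].
  by rewrite mE; apply/mlt_mul/(mlt_act pi) => // x; apply: sk.
pose c := f@_m / g@_m'.
exists << c *g (q, s) >> => n; rewrite poly_module_scale mcoeffB mcoeffZ.
rewrite mcoeff_mul_act (bigD1_seq m') ?fset_uniq -?mcoeff_neq0 //=.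
rewrite -mE big_seq_cond.
have [<-|mn] := eqVneq m n.
  rewrite big1 ?addr0 ?mulfVK ?subrr ?eqxx // => k /andP[+ km'].
  rewrite -mcoeff_neq0 => /lt[/eqP|]; first by rewrite (negbTE km').
  by case: eqP => // -> /mlt_irrefl.
rewrite add0r; have [|/fP[/eqP|//]] := eqVneq f@_n 0; last by rewrite eq_sym (negbTE mn).
move=> -> ; rewrite sub0r oppr_eq0 mulf_eq0 negb_or => /andP[_ sum0].
apply: contrapT => nm; case/negP: sum0; apply/eqP/big1 => k /andP[+ km'].
rewrite -mcoeff_neq0 => /lt[/eqP|]; first by rewrite (negbTE km').
by case: eqP => // ->.
Qed.

End Reduction.

(** * Finite generation *)

Section Span.
Variables (R : nzRingType) (V : lmodType R) (k : nat) (b : 'I_k -> V).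
Local Open Scope ring_scope.

Definition in_span (v : V) : Prop :=
  exists c : 'I_k -> R, v = \sum_(i < k) c i *: b i.

Lemma in_span0 : in_span 0.
Proof. by exists (fun=> 0); rewrite big1 // => i _; rewrite scale0r. Qed.

Lemma in_span_reduce (a : R) (i : 'I_k) v : in_span (v - a *: b i) -> in_span v.
Proof.
case=> c cE; exists (fun j => c j + a *+ (j == i)).
rewrite -[v](subrK (a *: b i)) cE (eq_bigr _ (fun _ _ => scalerDl _ _ _)) big_split.
congr (_ + _); rewrite (bigD1 i) //= eqxx big1 ?addr0 // => j /negbTE->.
by rewrite scale0r.
Qed.

End Span.

Theorem theorem1p1 (K : fieldType) (r : nat) (hr : (0 < r)%N) :
  @noetherian_module (skew_ring K r) (poly_module K r).
Proof.
move=> N [_ Nlin].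
have NB (a : skew_ring K r) (u v : poly_module K r) :
    u \in N -> v \in N -> (u - a *: v)%R \in N.
  by move=> uN vN; rewrite addrC -scaleNr; apply: Nlin.
have [B BP Bdom] := wqo_finite_basis
  (fun m => exists2 f : poly_module K r, f \in N & leading f m)
  (@shift_divides_wqo r).
have wit (i : 'I_(size B)) :
    exists f : poly_module K r, f \in N /\ leading f (tnth (in_tuple B) i).
  by have [f fN fl] := BP _ (mem_tnth i (in_tuple B)); exists f.
have [b bP] := choice wit.
exists (size B), b; split=> [i|]; first by case: (bP i).
suff red m : forall f : poly_module K r, f \in N -> leading f m -> in_span b f.
  move=> f fN; have [->|/leading_exists[m]] := eqVneq f 0%R; first exact: in_span0.
  exact: red.
elim/(well_founded_ind (@mlt_wf r)): m => m IHm f fN fm.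
have [m' m'B m'm] := Bdom m (ex_intro2 _ _ f fN fm).
have m'i : (index m' B < size B)%N by rewrite index_mem.
have [gN gm'] := bP (Ordinal m'i).
rewrite (tnth_nth m') /= nth_index // in gm'.
have [a aP] := reduction fm gm' m'm.
apply: (in_span_reduce (a := a) (i := Ordinal m'i)).
have [->|/leading_exists[n nP]] := eqVneq (f - a *: b (Ordinal m'i))%R 0%R.
  exact: in_span0.
by apply: (IHm n) => //; [apply: aP; case: nP | apply: NB].
Qed.
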